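(* Let $G$ be a graph, $k \geqslant 1$ and $r$ integers, and let $Q \subseteq V(G)$ be a $(k-1, r)$-cowitness for the pair $(V(G), G)$. If $G$ has no $r$-independent set of size $k$, then $Q$ is a $(k,r)$-witness in $G$.
   Context: Graphs are finite, simple and undirected; the length of a path is its number of edges. A set is $r$-independent if any two of its distinct vertices are at distance greater than $r$. For $X \subseteq V(G)$, $N_r(X)$ is the set of vertices at distance at most $r$ from some vertex of $X$. A short path is a path of length at most $r$. A set $Q$ captures a set $Y$ if some short path connecting two different vertices of $Y$ contains a vertex of $Q$ (endpoints included); $Q$ captures a pair $(Y,z)$ if some short path connecting some $y \in Y$ with $z$ contains a vertex of $Q$ (endpoints included). A $(k,r)$-witness is a set $Q$ such that every $X \subseteq V(G)$ with $|X| = k$ is captured by $Q$. For $A \subseteq V(G)$, a $(k,r)$-cowitness for $(A,G)$ is a set $Q \subseteq V(G)$ such that for every $X \subseteq A$ with $|X| = k$ and $A \subseteq N_r(X)$, and every $a \in A$, the pair $(X,a)$ is captured by $Q$. *)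

(* Defs.v *)
From HB Require Import structures.
From mathcomp Require Import all_boot all_order all_algebra.

Set Implicit Arguments.
Unset Strict Implicit.
Unset Printing Implicit Defensive.

Import Order.TTheory GRing.Theory Num.Theory.

Record sgraph := SGraph {
  svertex :> finType;
  sedge : rel svertex;
  sedge_sym : symmetric sedge;
  sedge_irr : irreflexive sedge }.

(* The path with vertex sequence x :: p, from x to y; its length is size p.
   The one-vertex path (x = y, p = [::]) is allowed. *)
Definition gpath (G : sgraph) (x y : G) (p : seq G) : bool :=
  [&& path (@sedge G) x p, last x p == y & uniq (x :: p)].

Definition has_gpath (G : sgraph) (x y : G) (n : nat) : bool :=
  [exists p : n.-tuple G, gpath x y p].

(* Length of a shortest path from x to y; None is the infinite distance
   between vertices of different components. Paths repeat no vertex, so only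
   lengths below #|G| have to be searched. *)
Definition dist (G : sgraph) (x y : G) : option nat :=
  let d := find (has_gpath x y) (iota 0 #|G|) in
  if d < #|G| then Some d else None.

Definition dist_le (G : sgraph) (x y : G) (r : int) : bool :=
  if dist x y is Some d then (d%:Z <= r)%R else false.

Definition short_path (G : sgraph) (r : int) (x y : G) (p : seq G) : bool :=
  gpath x y p && ((size p)%:Z <= r)%R.

Definition r_independent (G : sgraph) (r : int) (I : {set G}) : Prop :=
  forall x y : G, x \in I -> y \in I -> x != y -> ~~ dist_le x y r.

Definition nbhd (G : sgraph) (r : int) (X : {set G}) : {set G} :=
  [set v | [exists x in X, dist_le x v r]].

Definition captures (G : sgraph) (r : int) (Q Y : {set G}) : Prop :=
  exists x y : G, exists p : seq G,
    [/\ x \in Y, y \in Y, x != y, short_path r x y p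
      & exists2 q, q \in Q & q \in x :: p].

(* z may belong to Y, in which case the one-vertex path at z is admissible. *)
Definition captures_pair (G : sgraph) (r : int) (Q Y : {set G}) (z : G) : Prop :=
  exists y : G, exists p : seq G,
    [/\ y \in Y, short_path r y z p & exists2 q, q \in Q & q \in y :: p].

Definition witness (G : sgraph) (k : nat) (r : int) (Q : {set G}) : Prop :=
  forall X : {set G}, #|X| = k -> captures r Q X.

Definition cowitness (G : sgraph) (k : nat) (r : int) (A Q : {set G}) : Prop :=
  forall X : {set G}, X \subset A -> #|X| = k -> A \subset nbhd r X ->
  forall a : G, a \in A -> captures_pair r Q X a.

Lemma dist_leP (G : sgraph) (x y : G) (r : int) :
  reflect (exists p, short_path r x y p) (dist_le x y r).
Proof.
have has_size p : gpath x y p -> has_gpath x y (size p).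
  by move=> xyp; apply/existsP; exists (in_tuple p).
have size_lt p : gpath x y p -> size p < #|G|.
  by case/and3P=> _ _ /card_uniqP /= <-; exact: max_card.
rewrite /dist_le /dist; set d := find _ _.
apply: (iffP idP) => [|[p /andP[xyp ler]]].
  case: ifP => // ltd ler.
  have hd : has (has_gpath x y) (iota 0 #|G|) by rewrite has_find size_iota.
  have := nth_find 0 hd; rewrite -/d nth_iota // add0n => /existsP[p xyp].
  by exists p; rewrite /short_path xyp size_tuple.
have led : d <= size p.
  rewrite leqNgt; apply/negP => ltpd.
  have := before_find 0 ltpd.
  by rewrite nth_iota ?size_lt // add0n has_size.
rewrite (leq_ltn_trans led (size_lt _ xyp)).
by apply: le_trans ler; rewrite lez_nat.
Qed.

(* Main.v *)
Require Import Defs.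
From HB Require Import structures.
From mathcomp Require Import all_boot all_order all_algebra.

Set Implicit Arguments.
Unset Strict Implicit.
Unset Printing Implicit Defensive.

(** Call two vertices close if they are at distance at most [r], and call a
    vertex of [X] crowded if it is close to another vertex of [X]. A set [X] of
    [k] vertices is not [r]-independent, so it has a crowded vertex [x]. If
    [X :\ x] [r]-dominates the graph, the cowitness property applied to
    [(X :\ x, x)] shows that [X] is captured. Otherwise replace [x] by a vertex
    [v] far from [X :\ x]: no short path joins [v] to [X :\ x], so if the new
    set is captured then so was [X], and the new set has fewer crowded
    vertices. *)

Section ShortPaths.

Variable G : sgraph.
Implicit Types (x y : G) (p : seq G) (r : int) (X : {set G}).

Lemma gpath_rev x y p : gpath x y p -> gpath y x (rev (belast x p)).
Proof.
case/and3P=> xp /eqP <- uniq_xp; apply/and3P; split.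
- by rewrite rev_path (eq_path (e' := @sedge G)) // => a b; rewrite sedge_sym.
- by case: p {xp uniq_xp} => //= a p; rewrite rev_cons last_rcons.
- by rewrite -rev_rcons -lastI rev_uniq.
Qed.

Lemma short_path_rev r x y p :
  short_path r x y p -> short_path r y x (rev (belast x p)).
Proof.
by case/andP=> /gpath_rev yx ler; rewrite /short_path yx size_rev size_belast.
Qed.

Lemma dist_le_sym r x y : dist_le x y r = dist_le y x r.
Proof.
by apply/dist_leP/dist_leP => -[p /short_path_rev]; eexists; eassumption.
Qed.

Lemma dist_le_ge0 r x y : dist_le x y r -> (0 <= r)%R.
Proof. by case/dist_leP=> p /andP[_]; apply: Order.POrderTheory.le_trans. Qed.

Lemma dist_le_refl r x : dist_le x x r = (0 <= r)%R.
Proof.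
apply/idP/idP => [/dist_le_ge0 //|r0]; apply/dist_leP.
by exists [::]; rewrite /short_path /gpath /= eqxx.
Qed.

Lemma nbhdP {r X v} :
  reflect (exists2 x, x \in X & dist_le x v r) (v \in nbhd r X).
Proof. by rewrite inE; apply: exists_inP. Qed.

Lemma subset_nbhd r X : (0 <= r)%R -> X \subset nbhd r X.
Proof.
move=> r0; apply/subsetP => x xX.
by apply/nbhdP; exists x; rewrite ?dist_le_refl.
Qed.

End ShortPaths.

Definition crowded (G : sgraph) (r : int) (X : {set G}) : {set G} :=
  [set x in X | [exists y in X, (x != y) && dist_le x y r]].

Section CrowdedSets.

Variables (G : sgraph) (r : int).
Implicit Types (x y z v : G) (A I Q X Y : {set G}).

Lemma crowdedP {X x} :
  reflect (exists y, [/\ x \in X, y \in X, x != y & dist_le x y r])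
          (x \in crowded r X).
Proof.
rewrite inE; apply: (iffP andP) => [[xX /exists_inP[y yX /andP[xy xyr]]]|].
  by exists y.
by case=> y [xX yX xy xyr]; split=> //; apply/exists_inP; exists y; rewrite ?xy.
Qed.

Lemma crowded_eq0P {X} : reflect (r_independent r X) (crowded r X == set0).
Proof.
apply: (iffP eqP) => [X0 x y xX yX xy|indX].
  apply/negP => xyr; have: x \in crowded r X by apply/crowdedP; exists y.
  by rewrite X0 inE.
apply/setP => x; rewrite [RHS]inE; apply/crowdedP => -[y [xX yX xy]].
by apply/negP; apply: indX.
Qed.

Lemma crowded_sub X : crowded r X \subset X.
Proof. by apply/subsetP => x /crowdedP[y []]. Qed.

Lemma crowdedS X Y : Y \subset X -> crowded r Y \subset crowded r X.
Proof.
move=> /subsetP YX; apply/subsetP => y /crowdedP[z [yY zY yz yzr]].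
by apply/crowdedP; exists z; split; rewrite ?YX.
Qed.

Lemma crowdedD1_proper X x :
  x \in crowded r X -> crowded r (X :\ x) \proper crowded r X.
Proof.
move=> xX; apply/properP; split; first exact: crowdedS (subsetDl _ _).
by exists x => //; apply: contraFN (setD11 x X) => /(subsetP (crowded_sub _)).
Qed.

Lemma capturesS Q X Y : Y \subset X -> captures r Q Y -> captures r Q X.
Proof.
move=> /subsetP YX [y [z [p [yY zY yz yzp Qp]]]].
by exists y, z, p; split; rewrite ?YX.
Qed.

Lemma captures_pair_setU1 Q Y z :
  z \notin Y -> captures_pair r Q Y z -> captures r Q (z |: Y).
Proof.
move=> zY [y [p [yY yzp Qp]]]; exists y, z, p.
by split; rewrite ?setU11 ?setU1r //; apply: contraNneq zY => <-.
Qed.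

Lemma dist_le_setU1_far Y v y z :
    v \notin nbhd r Y -> y \in v |: Y -> z \in v |: Y -> y != z ->
  dist_le y z r -> y \in Y /\ z \in Y.
Proof.
move=> vfar; have far u : u \in Y -> dist_le u v r = false.
  by move=> uY; apply: contraNF vfar => uv; apply/nbhdP; exists u.
case/setU1P=> [->|yY] /setU1P[->|zY] //; first by rewrite eqxx.
  by rewrite dist_le_sym far.
by rewrite far.
Qed.

Lemma crowded_setU1_far Y v :
  v \notin nbhd r Y -> crowded r (v |: Y) = crowded r Y.
Proof.
move=> vfar; apply/eqP; rewrite eqEsubset andbC crowdedS ?subsetUr //=.
apply/subsetP => y /crowdedP[z [yvY zvY yz yzr]].
have [yY zY] := dist_le_setU1_far vfar yvY zvY yz yzr.
by apply/crowdedP; exists z.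
Qed.

Lemma captures_setU1_far Q Y v :
  v \notin nbhd r Y -> captures r Q (v |: Y) -> captures r Q Y.
Proof.
move=> vfar [y [z [p [yvY zvY yz yzp Qp]]]].
have yzr : dist_le y z r by apply/dist_leP; exists p.
have [yY zY] := dist_le_setU1_far vfar yvY zvY yz yzr.
by exists y, z, p.
Qed.

Lemma card_exchange_far X x v :
  x \in crowded r X -> v \notin nbhd r (X :\ x) -> #|v |: X :\ x| = #|X|.
Proof.
case/crowdedP=> y [xX _ _ /dist_le_ge0 r0] vfar.
have vX : v \notin X :\ x := contraNN (subsetP (subset_nbhd _ r0) v) vfar.
by rewrite cardsU1 vX [RHS](cardsD1 x) xX.
Qed.

Lemma cowitness_captures_or_far k A Q X x :
    cowitness k r A Q -> X \subset A -> #|X| = k.+1 -> x \in X ->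
  captures r Q X \/ exists2 v, v \in A & v \notin nbhd r (X :\ x).
Proof.
move=> coQ XA cardX xX.
have [dom|/subsetPn vfar] := boolP (A \subset nbhd r (X :\ x)); last by right.
left; rewrite -(setD1K xX); apply: captures_pair_setU1 (negbT (setD11 x X)) _.
apply: coQ dom _ (subsetP XA x xX); first exact: subset_trans (subsetDl _ _) XA.
by move: cardX; rewrite (cardsD1 x) xX => -[].
Qed.

Lemma cowitness_captures k A Q X :
    cowitness k r A Q ->
    (forall I, I \subset A -> r_independent r I -> #|I| <> k.+1) ->
  X \subset A -> #|X| = k.+1 -> captures r Q X.
Proof.
move=> coQ noindep; have [n] := ubnP #|crowded r X|.
elim: n X => // n IHn X ltXn XA cardX.
have [/crowded_eq0P indX|/set0Pn[x xcr]] := boolP (crowded r X == set0).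
  by case: (noindep X).
have xX := subsetP (crowded_sub X) x xcr.
have [//|[v vA vfar]] := cowitness_captures_or_far coQ XA cardX xX.
apply: capturesS (subsetDl X [set x]) _; apply: (captures_setU1_far vfar).
apply: IHn; last by rewrite card_exchange_far.
- rewrite crowded_setU1_far //.
  exact: leq_trans (proper_card (crowdedD1_proper xcr)) _.
- by rewrite subUset sub1set vA (subset_trans (subsetDl _ _)).
Qed.

End CrowdedSets.

Theorem mainTheorem4 (G : sgraph) (k : nat) (r : int) (Q : {set G})
  (hk : 1 <= k)
  (hQ : cowitness (k - 1) r [set: G] Q)
  (hindep : ~ exists I : {set G}, r_independent r I /\ #|I| = k) :
  witness k r Q.
Proof.
case: k hk hQ hindep => // k _; rewrite subSS subn0 => hQ hindep X.
apply: cowitness_captures hQ _ (subsetT X) => I _ indI cardI.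
by apply: hindep; exists I.
Qed.
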